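(* Let $M$ be a non-diagonalizable real $2\times 2$ matrix with (double) real eigenvalue $\sigma$, and let $\{\mathbf{v}_1,\mathbf{v}_2\}$ be an orthogonal basis of $\mathbb{R}^2$ such that $\mathbf{v}_1$ is an eigenvector of $M$ and $(M-\sigma\mathbb{I})\mathbf{v}_2=\mathbf{v}_1$. If $\sigma\ge 1$ and the vector $\mathbf{w}=\mu_1\mathbf{v}_1+\mu_2\mathbf{v}_2\neq\mathbf{0}$ is chosen with real coefficients such that $$\mu_1\mu_2\ge 0,\qquad \mu_2\neq 0,$$ then, for every integer $n\ge 2$, the Bézier curve of degree $n$ generated by $M$ and $\mathbf{w}$ has monotonic curvature $\kappa$ on $[0,1]$ (decreasing if $\kappa(0)>0$ and increasing if $\kappa(0)<0$).
   Context: Given a real $2\times2$ matrix $M$ and $\mathbf{w}\in\mathbb{R}^2\setminus\{\mathbf{0}\}$, the Bézier curve of degree $n$ generated by $M$ and $\mathbf{w}$ is $c(t)=\sum_{j=0}^n b_jB_j^n(t)$, $t\in[0,1]$, where $B_j^n(t)=\binom{n}{j}t^j(1-t)^{n-j}$ are the Bernstein polynomials and the control points $b_j\in\mathbb{R}^2$ satisfy $b_{j+1}-b_j=M^j\mathbf{w}$ for $j=0,\dots,n-1$ ($b_0$ is arbitrary). The (signed) curvature is $\kappa(t)=\det(c'(t),c''(t))/\Vert c'(t)\Vert^3$, with $\Vert\cdot\Vert$ the Euclidean norm. *)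

(* Defs.v *)
From HB Require Import structures.
From mathcomp Require Import all_boot all_order all_algebra.
From mathcomp Require Import all_classical all_reals all_analysis.

Set Implicit Arguments.
Unset Strict Implicit.
Unset Printing Implicit Defensive.

Import Order.TTheory GRing.Theory Num.Theory.
Import numFieldNormedType.Exports.

Local Open Scope ring_scope.

Definition dot (R : realType) (u v : 'cV[R]_2) : R := \sum_i u i 0 * v i 0.

(* The library norm on matrices is the sup norm, hence this one. *)
Definition enorm (R : realType) (u : 'cV[R]_2) : R := Num.sqrt (dot u u).

Definition bernstein (R : realType) (n j : nat) (t : R) : R :=
  'C(n, j)%:R * t ^+ j * (1 - t) ^+ (n - j).

(* Only b 0, ..., b n matter. The polynomial formula is taken on all of R, so
   that derivatives at 0 and 1 are the usual (one-sided) ones on [0, 1]. *)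
Definition bezier (R : realType) (n : nat) (b : nat -> 'cV[R]_2) (t : R) :
    'cV[R]_2 :=
  \sum_(j < n.+1) bernstein n j t *: b j.

Definition generated_by (R : realType) (n : nat) (M : 'M[R]_2) (w : 'cV[R]_2)
    (b : nat -> 'cV[R]_2) : Prop :=
  forall j : nat, (j < n)%N -> b j.+1 - b j = M ^+ j *m w.

Definition det2 (R : realType) (u v : 'cV[R]_2) : R :=
  \det (row_mx u v : 'M[R]_2).

Definition curvature (R : realType) (c : R -> 'cV[R]_2) (t : R) : R :=
  det2 (derive1 c t) (derive1 (derive1 c) t) / enorm (derive1 c t) ^+ 3.

(* Main.v *)
Require Import Defs.
From HB Require Import structures.
From mathcomp Require Import all_boot all_order all_algebra.
From mathcomp Require Import all_classical all_reals all_analysis.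
From mathcomp Require Import ring lra.

Set Implicit Arguments.
Unset Strict Implicit.
Unset Printing Implicit Defensive.

Import Order.TTheory GRing.Theory Num.Theory.
Import numFieldNormedType.Exports.

Local Open Scope ring_scope.

(** The derivative of a Bezier curve of degree [n] is [n] times the Bezier
    curve of degree [n - 1] on the differences of its control points
    ([derive1_bezier]).  Here these differences are [M ^+ j *m w], so the
    binomial theorem turns the velocity into
    [n *: ((1 - t)%:M + t *: M) ^+ (n - 1) *m w] ([bezier_powers]).  On [v1],
    [v2] the matrix [(1 - t)%:M + t *: M] is triangular with the double
    eigenvalue [s = 1 + (sigma - 1) * t] and off-diagonal entry [t], so its
    powers are explicit ([jordan_pow]): with [n = k + 2] the velocity is
    [n * s ^+ k] times
    [(s * mu1 + (k + 1) * t * mu2) *: v1 + (s * mu2) *: v2].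

    The ratio of the two coordinates is [mu1 / mu2 + (k + 1) * t / s], a
    linear fractional function of [t] with derivative [(k + 1) / s ^+ 2].
    The numerator of the curvature is therefore a constant times a power of
    [s], and after cancellation ([curvature_jordan]) the curvature is
    [- C / (s ^+ k * Q ^ (3 / 2))].  The constant [C] is nonzero because the
    nonzero vectors [v1], [v2] are orthogonal, and [Q] is the squared length
    of the vector above.  On the unit interval [s] is positive and
    nondecreasing because [sigma >= 1]; all terms of [Q] are nondecreasing,
    one of them strictly, because [mu1 * mu2 >= 0] ([jordan_speed2_lt]).  So
    the denominator strictly increases, and the sign of [C] decides the
    direction in which the curvature moves. *)

(** * Derivatives of Bernstein sums *)

Lemma is_derive_scaler_vec (R : realType) (V : normedModType R) (f : R -> R)
    (t df : R) (v : V) :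
  is_derive t 1 f df -> is_derive t 1 (fun x => f x *: v) (df *: v).
Proof.
move=> [fd <-].
have cv : ((fun h => h^-1 *:
     (((fun x => f x *: v) \o shift t) (h *: 1) - f t *: v)%R)
   @ 0^' --> ('D_1 f t *: v)%R)%classic.
  rewrite (_ : (fun h => _) =
    fun h => (h^-1 *: ((f \o shift t) (h *: 1) - f t)) *: v).
    by apply: cvgZr_tmp; exact: fd.
  by apply/funext => h /=; rewrite -scalerBl scalerA.
split; first by apply/cvg_ex; eexists; exact: cv.
exact: (cvg_lim _ cv).
Qed.

(** Vector-valued curves with polynomial coordinates are differentiated
    formally, which keeps limits out of all later computations. *)
Lemma derive1_horner_sum (R : realType) (V : normedModType R) n
    (p : 'I_n -> {poly R}) (v : 'I_n -> V) (t : R) :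
  derive1 (fun x => \sum_i (p i).[x] *: v i) t = \sum_i (p i)^`().[t] *: v i.
Proof.
rewrite derive1E.
rewrite (_ : (fun x => _) = \sum_i (fun x => (p i).[x] *: v i)); last first.
  by apply/funext => x; rewrite fct_sumE.
have ? : is_derive t 1 (\sum_i (fun x => (p i).[x] *: v i))
    (\sum_i (p i)^`().[t] *: v i).
  by apply: is_derive_sum => i; apply: is_derive_scaler_vec;
    exact: is_derive_poly.
exact: derive_val.
Qed.

Definition bernsteinp (R : realType) (n j : nat) : {poly R} :=
  'C(n, j)%:R *: ('X ^+ j * (1 - 'X) ^+ (n - j)).

Lemma horner_bernsteinp (R : realType) n j (t : R) :
  (bernsteinp R n j).[t] = bernstein n j t.
Proof. by rewrite /bernsteinp /bernstein !hornerE. Qed.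

Lemma deriv_bernsteinp0 (R : realType) n :
  (bernsteinp R n.+1 0)^`() = - (n.+1%:R *: bernsteinp R n 0).
Proof.
rewrite /bernsteinp !bin0 !scale1r !expr0 !mul1r !subn0.
rewrite deriv_exp !poly.derivE /= sub0r mulN1r mulNrn; congr (- _).
by rewrite scaler_nat.
Qed.

(** Holds for all [j] because [bernsteinp n j] vanishes for [n < j]; hence no
    separate formula is needed for the last Bernstein polynomial. *)
Lemma deriv_bernsteinpS (R : realType) n j :
  (bernsteinp R n.+1 j.+1)^`()
  = n.+1%:R *: (bernsteinp R n j - bernsteinp R n j.+1).
Proof.
rewrite /bernsteinp subSS.
have [ltnj | ] := ltnP n j.
  rewrite !bin_small // ?ltnS ?leqW 1?ltnW //.
  by rewrite !mulr0n !scale0r linear0 subrr scaler0.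
rewrite leq_eqVlt => /orP[/eqP ->|ltjn].
  rewrite !binn bin_small // mulr0n scale0r subr0 subnn expr0 !mulr1 !scale1r.
  by rewrite derivXn scaler_nat.
have -> : (n - j = (n - j.+1).+1)%N by rewrite subnSK.
set m := (n - j.+1)%N.
rewrite derivZ derivM derivXn deriv_exp !poly.derivE /= sub0r mulN1r.
rewrite scalerBr !scalerA -!natrM mul_bin_diag.
have -> : (n.+1 * 'C(n, j.+1) = m.+1 * 'C(n.+1, j.+1))%N.
  by rewrite mul_bin_down subSS /m subnSK.
rewrite !scaler_nat /=; ring.
Qed.

Lemma bezierE (R : realType) n (b : nat -> 'cV[R]_2) :
  bezier n b = fun t => \sum_(j < n.+1) (bernsteinp R n j).[t] *: b j.
Proof.
by apply/funext => t; apply: eq_bigr => j _; rewrite horner_bernsteinp.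
Qed.

(** The classical hodograph formula, by summation by parts on
    [deriv_bernsteinpS]. *)
Lemma derive1_bezier (R : realType) n (b : nat -> 'cV[R]_2) (t : R) :
  derive1 (bezier n.+1 b) t
  = n.+1%:R *: bezier n (fun j => b j.+1 - b j) t.
Proof.
rewrite !bezierE derive1_horner_sum.
(* The padded sum makes the telescoping exact: its last weight is zero. *)
have pad : \sum_(j < n.+1) (bernsteinp R n j).[t] *: b j =
    (bernsteinp R n 0).[t] *: b 0 +
    \sum_(j < n.+1) (bernsteinp R n j.+1).[t] *: b j.+1.
  transitivity (\sum_(j < n.+2) (bernsteinp R n j).[t] *: b j); last first.
    by rewrite big_ord_recl.
  rewrite [RHS]big_ord_recr /= {3}/bernsteinp bin_small // mulr0n scale0r.
  by rewrite horner0 scale0r addr0.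
under [in RHS]eq_bigr => j _ do rewrite scalerBr.
rewrite sumrB pad big_ord_recl /= deriv_bernsteinp0.
under eq_bigr => j _ do
  rewrite deriv_bernsteinpS hornerZ hornerD hornerN -scalerA scalerBl.
rewrite -scaler_sumr sumrB hornerN hornerZ scaleNr -scalerA -scalerN -scalerDr.
by rewrite opprD addrCA.
Qed.

(** * Curves generated by a Jordan block *)

(** The binomial theorem for the commuting matrices [(1 - t)%:M] and
    [t *: M]. *)
Lemma bezier_powers (R : realType) n (M : 'M[R]_2) (w : 'cV[R]_2) (t : R) :
  bezier n (fun j => M ^+ j *m w) t = ((1 - t)%:M + t *: M) ^+ n *m w.
Proof.
have cM : GRing.comm ((1 - t)%:M : 'M[R]_2) (t *: M).
  by rewrite /GRing.comm -!mulmxE scalar_mxC.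
rewrite (exprDn_comm _ cM) mulmx_suml; apply: eq_bigr => j _.
rewrite /bernstein -[_%:M]scalemx1 !exprZn expr1n mulr_algl.
rewrite scalerA -[in RHS]scaler_nat scalerA -scalemxAl; congr (_ *: _).
by rewrite -mulrA [t ^+ _ * _]mulrC.
Qed.

(** In the basis [v1], [v2] the matrix is [s] plus [t] times a nilpotent of
    square zero, so only two terms of the binomial expansion survive. *)
Lemma jordan_pow (R : realType) (M : 'M[R]_2) (s t x y : R)
    (v1 v2 : 'cV[R]_2) k :
  M *m v1 = s *: v1 -> M *m v2 = s *: v2 + t *: v1 ->
  M ^+ k.+1 *m (x *: v1 + y *: v2) =
  (s ^+ k * (s * x + k.+1%:R * t * y)) *: v1 + (s ^+ k.+1 * y) *: v2.
Proof.
move=> Mv1 Mv2; elim: k => [|k IH].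
  rewrite !expr1 mulmxDr -!scalemxAr Mv1 Mv2 expr0 mul1r.
  rewrite scalerDr !scalerA addrCA addrC -!scalerDl.
  by congr (_ *: _ + _ *: _); ring.
rewrite [in LHS]exprS -mulmxE -mulmxA IH mulmxDr -!scalemxAr Mv1 Mv2.
rewrite scalerDr !scalerA addrA addrAC -!scalerDl.
by congr (_ *: _ + _ *: _); rewrite !exprS ?[in RHS]mulrS; ring.
Qed.

(** * Plane vectors and curvature in an orthogonal frame *)

Lemma det_mx2 (R : comNzRingType) (A : 'M[R]_2) :
  \det A = A 0 0 * A 1 1 - A 1 0 * A 0 1.
Proof.
rewrite (expand_det_col _ 0) !big_ord_recl big_ord0 /cofactor !det_mx11 !mxE.
rewrite (_ : lift 0 0 = 1); last exact: val_inj.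
rewrite (_ : lift 1 0 = 0); last exact: val_inj.
by rewrite /= expr0 expr1; ring.
Qed.

Lemma det2E (R : realType) (u v : 'cV[R]_2) :
  det2 u v = u 0 0 * v 1 0 - u 1 0 * v 0 0.
Proof.
have colu i : (row_mx u v : 'M[R]_2) i 0 = u i 0.
  rewrite -(row_mxEl u v i 0); congr (row_mx _ _ _ _); exact: val_inj.
have colv i : (row_mx u v : 'M[R]_2) i 1 = v i 0.
  rewrite -(row_mxEr u v i 0); congr (row_mx _ _ _ _); exact: val_inj.
by rewrite /det2 det_mx2 !colu !colv.
Qed.

Lemma dotE (R : realType) (u v : 'cV[R]_2) :
  dot u v = u 0 0 * v 0 0 + u 1 0 * v 1 0.
Proof.
rewrite /dot !big_ord_recl big_ord0 addr0.
by rewrite (_ : lift 0 0 = 1) //; exact: val_inj.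
Qed.

Lemma dot_gt0 (R : realType) (u : 'cV[R]_2) : u != 0 -> 0 < dot u u.
Proof.
move=> u0; have dge0 : 0 <= dot u u by apply: sumr_ge0 => i _; exact: sqr_ge0.
rewrite lt0r dge0 andbT; apply: contra u0.
rewrite psumr_eq0 => [/allP u0|i _]; last exact: sqr_ge0.
apply/eqP/colP => i; rewrite mxE; apply/eqP.
by have := u0 i (mem_index_enum _); rewrite mulf_eq0 orbb.
Qed.

(** Lagrange's identity: the squared determinant is the product of the squared
    lengths minus the squared dot product. *)
Lemma det2_neq0_orthogonal (R : realType) (u v : 'cV[R]_2) :
  dot u v = 0 -> u != 0 -> v != 0 -> det2 u v != 0.
Proof.
move=> uv u0 v0.
have lagrange : det2 u v ^+ 2 = dot u u * dot v v - dot u v ^+ 2.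
  by rewrite det2E !dotE; ring.
by rewrite -sqrf_eq0 lagrange uv expr0n subr0 mulf_neq0 // gt_eqF // dot_gt0.
Qed.

(** In a constant frame the numerator of the curvature is the Wronskian of the
    coordinates of the velocity times the determinant of the frame. *)
Lemma curvature_orthogonal_frame (R : realType) (c : R -> 'cV[R]_2)
    (p q : {poly R}) (v1 v2 : 'cV[R]_2) (t : R) :
  dot v1 v2 = 0 ->
  (forall x, derive1 c x = p.[x] *: v1 + q.[x] *: v2) ->
  curvature c t = (p * q^`() - p^`() * q).[t] * det2 v1 v2 /
    Num.sqrt (p.[t] ^+ 2 * dot v1 v1 + q.[t] ^+ 2 * dot v2 v2) ^+ 3.
Proof.
move=> v12 dc.
have ddc : derive1 (derive1 c) t = p^`().[t] *: v1 + q^`().[t] *: v2.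
  transitivity (derive1 (fun x => \sum_i (nth 0 [:: p; q] (i : 'I_2)).[x]
      *: (nth 0 [:: v1; v2] i)) t).
    congr (derive1 _ t); apply/funext => x.
    by rewrite dc !big_ord_recl big_ord0 addr0.
  by rewrite derive1_horner_sum !big_ord_recl big_ord0 addr0.
have det_frame (x y x' y' : R) : det2 (x *: v1 + y *: v2) (x' *: v1 + y' *: v2)
    = (x * y' - x' * y) * det2 v1 v2.
  by rewrite !det2E !mxE; ring.
have dot_frame (x y : R) : dot (x *: v1 + y *: v2) (x *: v1 + y *: v2)
    = x ^+ 2 * dot v1 v1 + y ^+ 2 * dot v2 v2 + 2 * x * y * dot v1 v2.
  by rewrite !dotE !mxE; ring.
rewrite /curvature ddc dc det_frame /enorm dot_frame v12 mulr0 addr0.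
by rewrite !hornerE.
Qed.

(** * Curvature of a curve generated by a Jordan block *)

(** On [v1], [v2] the matrix [(1 - t)%:M + t *: M] is triangular, with the
    double eigenvalue [s] and off-diagonal entry [t]. *)
Lemma hodograph_jordan (R : realType) k (M : 'M[R]_2) (sigma mu1 mu2 : R)
    (v1 v2 : 'cV[R]_2) (b : nat -> 'cV[R]_2) (t : R)
    (s := 1 + (sigma - 1) * t) :
  M *m v1 = sigma *: v1 -> M *m v2 = sigma *: v2 + v1 ->
  generated_by k.+2 M (mu1 *: v1 + mu2 *: v2) b ->
  derive1 (bezier k.+2 b) t =
    (k.+2%:R * s ^+ k * (s * mu1 + k.+1%:R * t * mu2)) *: v1 +
    (k.+2%:R * s ^+ k.+1 * mu2) *: v2.
Proof.
move=> Mv1 Mv2 bM; rewrite derive1_bezier.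
have -> : bezier k.+1 (fun j => b j.+1 - b j) t =
    bezier k.+1 (fun j => M ^+ j *m (mu1 *: v1 + mu2 *: v2)) t.
  by apply: eq_bigr => j _; rewrite bM.
rewrite bezier_powers (@jordan_pow _ _ s t).
- by rewrite scalerDr !scalerA !mulrA.
- rewrite mulmxDl mul_scalar_mx -scalemxAl Mv1 scalerA -scalerDl.
  by congr (_ *: _); rewrite /s; ring.
- rewrite mulmxDl mul_scalar_mx -scalemxAl Mv2 scalerDr scalerA addrA -scalerDl.
  by congr (_ *: _ + _); rewrite /s; ring.
Qed.

(** The squared length of [(s * mu1 + r * mu2) *: v1 + (s * mu2) *: v2] for
    orthogonal [v1], [v2] of squared lengths [a], [d].  Keeping [s] and [r]
    independent separates the weak growth in [s] from the strict growth in
    [r]. *)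
Definition jordan_speed2 (R : realType) (mu1 mu2 a d s r : R) : R :=
  (s * mu1 + r * mu2) ^+ 2 * a + (s * mu2) ^+ 2 * d.

(** Both coordinates of the velocity share the factor [n * s ^+ k], and the
    Wronskian of [P * f] and [P * g] is [P ^+ 2] times that of [f] and [g].
    For the remaining linear [f] and [g] it is a constant, so that all the
    dependence on [t] sits in the denominator. *)
Lemma curvature_jordan (R : realType) k (M : 'M[R]_2) (sigma mu1 mu2 : R)
    (v1 v2 : 'cV[R]_2) (b : nat -> 'cV[R]_2) (t : R)
    (s := 1 + (sigma - 1) * t) :
  dot v1 v2 = 0 ->
  M *m v1 = sigma *: v1 -> M *m v2 = sigma *: v2 + v1 ->
  generated_by k.+2 M (mu1 *: v1 + mu2 *: v2) b ->
  0 < s ->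
  curvature (bezier k.+2 b) t =
    - (k.+1%:R / k.+2%:R * mu2 ^+ 2 * det2 v1 v2) /
    (s ^+ k * Num.sqrt (jordan_speed2 mu1 mu2 (dot v1 v1) (dot v2 v2)
                          s (k.+1%:R * t)) ^+ 3).
Proof.
rewrite /jordan_speed2 => v12 Mv1 Mv2 bM s0.
pose S : {poly R} := 1%:P + (sigma - 1) *: 'X.
pose P := (k.+2%:R : R) *: S ^+ k.
pose p := P * (mu1 *: S + (k.+1%:R * mu2) *: 'X).
pose q := P * (mu2 *: S).
pose hE := (hornerZ, hornerM, hornerN, hornerC, horner_exp, hornerD, hornerX).
have dc x : derive1 (bezier k.+2 b) x = p.[x] *: v1 + q.[x] *: v2.
  rewrite (hodograph_jordan _ Mv1 Mv2 bM) /p /q !hE !exprS.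
  by congr (_ *: _ + _ *: _); ring.
rewrite (curvature_orthogonal_frame _ v12 dc).
have wronskian : (p * q^`() - p^`() * q).[t] =
    - (k.+2%:R ^+ 2 * k.+1%:R * mu2 ^+ 2 * s ^+ k ^+ 2).
  have dS : S^`() = (sigma - 1)%:P.
    by rewrite derivD derivC add0r derivZ derivX alg_polyC.
  rewrite (_ : _ - _ = P ^+ 2 * - (k.+1%:R * mu2 ^+ 2)%:P).
    by rewrite /P !hE /s; ring.
  rewrite /p /q !derivM !derivD !derivZ dS derivX -!mul_polyC.
  (* [S - (sigma - 1) X] is the constant 1: the Wronskian loses its last
     occurrence of X here. *)
  rewrite (_ : P ^+ 2 * _ =
    P ^+ 2 * - (k.+1%:R * mu2 ^+ 2)%:P * (S - (sigma - 1)%:P * 'X)).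
    by rewrite !polyCM; ring.
  by rewrite /S -mul_polyC addrK polyC1 mulr1.
set L := s * mu1 + k.+1%:R * t * mu2.
have -> : p.[t] = k.+2%:R * s ^+ k * L.
  by rewrite /p /P !hE /L /s; ring.
have -> : q.[t] = k.+2%:R * s ^+ k * (s * mu2).
  by rewrite /q /P !hE /s; ring.
(* The common factor is positive and leaves the square root as its cube. *)
rewrite wronskian 2!(exprMn _ (k.+2%:R * s ^+ k)) -!(mulrA (_ ^+ 2)) -mulrDr.
have c0 : 0 < k.+2%:R * s ^+ k by rewrite mulr_gt0 ?exprn_gt0.
rewrite sqrtrM ?sqr_ge0 // sqrtr_sqr gtr0_norm // (exprMn 3).
(* The cube is made opaque so that inversion distributes only around it. *)
set r3 := Num.sqrt _ ^+ 3; move: r3 => r3; rewrite !(invfM _ r3).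
have sk0 : s ^+ k != 0 by rewrite gt_eqF ?exprn_gt0.
have n0 : (k.+2%:R : R) != 0 by rewrite pnatr_eq0.
rewrite exprMn; move: (s ^+ k) (k.+2%:R : R) (r3^-1) sk0 n0 => Sk N y sk0 n0.
by field; rewrite sk0 n0.
Qed.

(** * Monotonicity *)

(** For coefficients of the same sign the cross term of the square is
    nondecreasing in [s] and [r], and [mu2 != 0] makes the [r ^+ 2] term
    strictly increasing. *)
Lemma jordan_speed2_lt (R : realType) (mu1 mu2 a d s s' r r' : R) :
  0 <= mu1 * mu2 -> mu2 != 0 -> 0 < a -> 0 < d ->
  0 < s <= s' -> 0 <= r < r' ->
  0 < jordan_speed2 mu1 mu2 a d s r < jordan_speed2 mu1 mu2 a d s' r'.
Proof.
move=> mu12 mu2n0 a0 d0 /andP[s0 ss'] /andP[r0 rr'].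
have s'0 : 0 < s' by exact: lt_le_trans ss'.
have mu22 : 0 < mu2 ^+ 2 by rewrite exprn_even_gt0.
have s2 : s ^+ 2 <= s' ^+ 2 by rewrite ler_pXn2r // nnegrE ltW.
apply/andP; split.
  apply: ltr_wpDl; first by rewrite mulr_ge0 ?sqr_ge0 // ltW.
  by rewrite mulr_gt0 // exprMn mulr_gt0 // exprn_gt0.
apply: ltr_leD; last by rewrite !exprMn ler_pM2r // ler_pM2r.
have expand (u v : R) : (u * mu1 + v * mu2) ^+ 2 =
  u ^+ 2 * mu1 ^+ 2 + (u * v) * (mu1 * mu2) *+ 2 + v ^+ 2 * mu2 ^+ 2 by ring.
rewrite ltr_pM2r // !expand; apply: ler_ltD; first apply: lerD.
- by rewrite ler_wpM2r ?sqr_ge0.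
- by rewrite lerMn2r ler_wpM2r // ler_pM // ltW.
- by rewrite ltr_pM2r // ltr_pXn2r // nnegrE // ltW // (le_lt_trans r0).
Qed.

Theorem theorem4 (R : realType) (M : 'M[R]_2) (sigma : R)
    (v1 v2 w : 'cV[R]_2) (mu1 mu2 : R)
    (M_nondiag : ~ diagonalizable M)
    (sigma_double : mup sigma (char_poly M) = 2%N)
    (v12_basis : basis_of fullv [:: v1; v2])
    (v12_orthogonal : dot v1 v2 = 0)
    (v1_neq0 : v1 != 0)
    (v1_eigen : M *m v1 = sigma *: v1)
    (v2_eq : (M - sigma%:M) *m v2 = v1)
    (sigma_ge1 : 1 <= sigma)
    (w_eq : w = mu1 *: v1 + mu2 *: v2)
    (w_neq0 : w != 0)
    (mu12_ge0 : 0 <= mu1 * mu2)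
    (mu2_neq0 : mu2 != 0)
    (n : nat) (n_ge2 : (2 <= n)%N)
    (b : nat -> 'cV[R]_2) (b_gen : generated_by n M w b) :
  let kappa := curvature (bezier n b) in
  [/\ {in `[0, 1] &, {homo kappa : x y / x < y}} \/
      {in `[0, 1] &, {homo kappa : x y /~ x < y}},
      0 < kappa 0 -> {in `[0, 1] &, {homo kappa : x y /~ x < y}}
    & kappa 0 < 0 -> {in `[0, 1] &, {homo kappa : x y / x < y}}].
Proof.
move=> kappa.
have v2_neq0 : v2 != 0.
  by apply: contra v1_neq0 => /eqP v20; rewrite -v2_eq v20 mulmx0.
have Mv2 : M *m v2 = sigma *: v2 + v1.
  by rewrite -v2_eq mulmxBl mul_scalar_mx addrC subrK.
case: n n_ge2 b_gen @kappa => [//|[//|k]] _ bM kappa; rewrite w_eq in bM.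
pose C : R := k.+1%:R / k.+2%:R * mu2 ^+ 2 * det2 v1 v2.
have C_neq0 : C != 0.
  by rewrite !mulf_neq0 ?invr_eq0 ?pnatr_eq0 ?expf_neq0 // det2_neq0_orthogonal.
pose s (t : R) := 1 + (sigma - 1) * t.
pose Q t := jordan_speed2 mu1 mu2 (dot v1 v1) (dot v2 v2) (s t) (k.+1%:R * t).
pose g t := s t ^+ k * Num.sqrt (Q t) ^+ 3.
have kappaE t : 0 <= t -> kappa t = - C / g t.
  move=> t0; apply: (curvature_jordan v12_orthogonal v1_eigen Mv2 bM).
  by nra.
have g_incr x y : 0 <= x -> x < y -> 0 < g x < g y.
  move=> x0 xy; have sx : 0 < s x by rewrite /s; nra.
  have sxy : s x <= s y by rewrite /s; nra.
  have /andP[Qx Qxy] : 0 < Q x < Q y.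
    apply: jordan_speed2_lt; rewrite ?dot_gt0 ?sx //.
    by rewrite mulr_ge0 ?ltr_pM2l ?ltr0n.
  have gx : 0 < g x by rewrite mulr_gt0 ?exprn_gt0 ?sqrtr_gt0.
  have sy : 0 < s y by exact: lt_le_trans sxy.
  rewrite gx /=; apply: (@lt_le_trans _ _ (s x ^+ k * Num.sqrt (Q y) ^+ 3)).
    rewrite ltr_pM2l ?exprn_gt0 // ltr_pXn2r ?nnegrE ?sqrtr_ge0 //.
    by rewrite ltr_sqrt // (lt_trans Qx).
  by rewrite ler_wpM2r ?exprn_ge0 ?sqrtr_ge0 // lerXn2r
    ?nnegrE ?(ltW sx) ?(ltW sy).
have ge0 x : x \in `[0, 1] -> 0 <= x by rewrite in_itv => /andP[].
have incr : 0 < C -> {in `[0, 1] &, {homo kappa : x y / x < y}}.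
  move=> C0 x y /ge0 x0 /ge0 y0 xy; have /andP[gx gxy] := g_incr x y x0 xy.
  rewrite !kappaE // !mulNr ltrN2 ltr_pM2l // ltf_pV2 // posrE.
  exact: lt_trans gxy.
have decr : C < 0 -> {in `[0, 1] &, {homo kappa : x y /~ x < y}}.
  move=> C0 x y /ge0 x0 /ge0 y0 yx; have /andP[gy gyx] := g_incr y x y0 yx.
  rewrite !kappaE // ltr_pM2l ?oppr_gt0 // ltf_pV2 // posrE.
  exact: lt_trans gyx.
have kappa0 : kappa 0 = - C / g 0 by exact: kappaE.
have g0 : 0 < (g 0)^-1.
  by rewrite invr_gt0; have /andP[] := g_incr 0 1 (lexx 0) ltr01.
split.
- by move: C_neq0; rewrite neq_lt => /orP[/decr|/incr]; [right|left].
- by rewrite kappa0 pmulr_lgt0 // oppr_gt0.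
- by rewrite kappa0 pmulr_llt0 // oppr_lt0.
Qed.
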